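(* For any tree $T$ of order $n\ge 2$, $$\alpha_{\mathrm{bn}}(T)\leq n-b(T)+\rho(T).$$
   Context: Graphs are finite and simple; $d(u,v)$ is distance and $e(v)$ is the eccentricity of $v$. A broadcast on a nontrivial connected graph $G=(V,E)$ is a function $f:V\to\{0,1,\dots,\operatorname{diam}(G)\}$ with $f(v)\le e(v)$ for all $v\in V$. Its weight is $\sigma(f)=\sum_{v\in V}f(v)$, and $V_f^+=\{v\in V: f(v)>0\}$ is the set of broadcasting vertices. A vertex $u$ hears $f$ from $v\in V_f^+$ if $d(u,v)\le f(v)$. For $v\in V_f^+$ let $N_f(v)=\{u\in V:d(u,v)\le f(v)\}$ and $B_f(v)=\{u\in V:d(u,v)=f(v)\}$. The broadcast $f$ is boundary independent (bn-independent) if, whenever a vertex $w$ hears $f$ from two or more broadcasting vertices, $d(w,v)=f(v)$ for each $v$ from which $w$ hears $f$; equivalently, $N_f(u)\cap N_f(v)\subseteq B_f(u)\cap B_f(v)$ for all distinct $u,v\in V_f^+$. $\alpha_{\mathrm{bn}}(G)$ denotes the maximum weight of a bn-independent broadcast on $G$. For a tree $T$, a leaf is a vertex of degree $1$ and a branch vertex is a vertex of degree at least $3$. $B(T)$ is the set of branch vertices and $b(T)=|B(T)|$. An endpath is a path ending in a leaf and having all internal vertices (if any) of degree $2$ in $T$. For a branch vertex $v$, the leaf set $L(v)$ is the set of leaves $l$ of $T$ such that the path from $v$ to $l$ is an endpath (that is, all its internal vertices have degree $2$ in $T$). $R(T)$ is the set of all branch vertices $w$ with $|L(w)|\le 1$,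 and $\rho(T)=|R(T)|$. *)

(* Defs.v *)
From HB Require Import structures.
From mathcomp Require Import all_boot.
Set Implicit Arguments.
Unset Strict Implicit.
Unset Printing Implicit Defensive.

(* A graph on the vertex set T is given by its adjacency relation e. *)

Definition simple_graph (T : finType) (e : rel T) : Prop :=
  symmetric e /\ irreflexive e.

Definition connected_graph (T : finType) (e : rel T) : Prop :=
  forall u v : T, connect e u v.

(* For symmetric e, ucycle e [:: u; v] holds on every edge, hence the bound
   on the size of c. *)
Definition acyclic_graph (T : finType) (e : rel T) : Prop :=
  forall c : seq T, 2 < size c -> ~ ucycle e c.

Definition tree (T : finType) (e : rel T) : Prop :=
  [/\ simple_graph e, connected_graph e & acyclic_graph e].

(* u :: p is a path of length size p from u to v. *)
Definition upath (T : finType) (e : rel T) (u v : T) (p : seq T) : bool :=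
  [&& path e u p, last u p == v & uniq (u :: p)].

(* The least length of a path from u to v. Paths have length less than #|T|;
   the value is #|T| when there is no path, which does not happen in a
   connected graph. *)
Definition dist (T : finType) (e : rel T) (u v : T) : nat :=
  find (fun n => [exists p : n.-tuple T, upath e u v p]) (iota 0 #|T|).

Definition ecc (T : finType) (e : rel T) (v : T) : nat :=
  \max_(u : T) dist e v u.

Definition diam (T : finType) (e : rel T) : nat := \max_(v : T) ecc e v.

Definition is_broadcast (T : finType) (e : rel T)
    (f : {ffun T -> 'I_(diam e).+1}) : bool :=
  [forall v, f v <= ecc e v].

Definition weight (T : finType) (e : rel T)
    (f : {ffun T -> 'I_(diam e).+1}) : nat :=
  \sum_(v : T) f v.

(* The broadcasting vertices from which u hears f. *)
Definition heard_from (T : finType) (e : rel T)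
    (f : {ffun T -> 'I_(diam e).+1}) (u : T) : {set T} :=
  [set v | (0 < f v) && (dist e u v <= f v)].

Definition bn_independent (T : finType) (e : rel T)
    (f : {ffun T -> 'I_(diam e).+1}) : bool :=
  [forall w, (2 <= #|heard_from f w|) ==>
    [forall v in heard_from f w, dist e w v == f v]].

Definition alpha_bn (T : finType) (e : rel T) : nat :=
  \max_(f : {ffun T -> 'I_(diam e).+1} | is_broadcast f && bn_independent f)
    weight f.

Definition degree (T : finType) (e : rel T) (v : T) : nat :=
  #|[set u | e v u]|.

Definition leaf (T : finType) (e : rel T) (v : T) : bool := degree e v == 1.

Definition branch_set (T : finType) (e : rel T) : {set T} :=
  [set v | 3 <= degree e v].

(* behead (belast v p) lists the internal vertices of the path v :: p. *)
Definition endpath (T : finType) (e : rel T) (v l : T) (p : seq T) : bool :=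
  [&& upath e v l p, leaf e l
    & all (fun x => degree e x == 2) (behead (belast v p))].

Definition leaf_set (T : finType) (e : rel T) (v : T) : {set T} :=
  [set l | [exists n : 'I_#|T|, exists p : n.-tuple T, endpath e v l p]].

Definition R_set (T : finType) (e : rel T) : {set T} :=
  [set w in branch_set e | #|leaf_set e w| <= 1].

(* Main.v *)
Require Import Defs.
From mathcomp Require Import all_boot.
Set Implicit Arguments.
Unset Strict Implicit.
Unset Printing Implicit Defensive.

(** Some vertex [w0] lies in the interior of no broadcast ball: otherwise, by
    connectedness, one broadcast ball would contain every vertex in its
    interior, against [f v <= ecc v].  Root the graph at [w0] along a
    breadth-first tree and let each [v] claim the first [f v] vertices on its
    way to the root.  Claimed sets are disjoint and avoid [w0], so the weight
    is the number of claimed vertices.  If a branch vertex [w] has two endpaths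
    that avoid the root, with first vertices [c1] and [c2], then [w], [c1],
    [c2] are not all claimed: [c1] and [c2] would be claimed by distinct
    vertices, both heard by [w], while [w] is interior to the ball of its own
    claimant.  The root meets the endpaths of at most one branch vertex, and
    [w0] itself pays for that one. *)

(** * Distances as lengths of shortest walks *)

(** Repeated vertices are cut out by [shortenP], so walks may later be extended or reversed without
    checking [uniq]. *)
Lemma dist_path_leq (T : finType) (e : rel T) (u : T) (p : seq T) :
  path e u p -> dist e u (last u p) <= size p.
Proof.
move=> pP; case/shortenP: pP => q qP qU sub_qp.
have szq : size q < #|T| by have := max_card (mem (u :: q)); rewrite (card_uniqP qU).
have leq_qp : size q <= size p.
  by apply: uniq_leq_size; [case/andP: qU | exact: sub_qp].
apply: leq_trans leq_qp; rewrite /dist leqNgt; apply/negP => lt_find.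
have /negP := negbT (before_find 0 lt_find); rewrite nth_iota // add0n; apply.
apply/existsP; exists (in_tuple q).
by rewrite /upath qP eqxx.
Qed.

(** A simple path is shorter than [#|T|], so the search in [dist] succeeds and its default value
    does not occur. *)
Lemma dist_witness (T : finType) (e : rel T) (u v : T) :
  connect e u v -> exists p, [/\ path e u p, last u p = v & size p = dist e u v].
Proof.
case/connectP => p pP ->; case/shortenP: pP => q qP qU _.
have szq : size q < #|T| by have := max_card (mem (u :: q)); rewrite (card_uniqP qU).
set a := fun n => [exists p : n.-tuple T, upath e u (last u q) p].
have has_a : has a (iota 0 #|T|).
  apply/hasP; exists (size q); first by rewrite mem_iota.
  by apply/existsP; exists (in_tuple q); rewrite /upath qP eqxx.
have := nth_find 0 has_a; rewrite -/(dist e u (last u q)).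
rewrite /a nth_iota; last by rewrite -[X in _ < X](size_iota 0) -has_find.
rewrite add0n => /existsP[t /and3P[tP /eqP tl _]].
by exists t; rewrite size_tuple.
Qed.

Lemma distxx (T : finType) (e : rel T) (u : T) : dist e u u = 0.
Proof. by apply/eqP; rewrite -leqn0; exact: (@dist_path_leq _ e u [::]). Qed.

Lemma dist_sym (T : finType) (e : rel T) (u v : T) :
  symmetric e -> connected_graph e -> dist e u v = dist e v u.
Proof.
move=> symE conE; wlog suff: u v / dist e u v <= dist e v u.
  by move=> H; apply/eqP; rewrite eqn_leq !H.
have [p [pP <- <-]] := dist_witness (conE v u).
have := @dist_path_leq _ e (last v p) (rev (belast v p)).
rewrite size_rev size_belast rev_path (eq_path (e' := e)); last by move=> x y /=.
have -> : last (last v p) (rev (belast v p)) = v.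
  by case: (p) => //= x q; rewrite rev_cons last_rcons.
exact.
Qed.

Lemma dist_edge (T : finType) (e : rel T) (x y u : T) :
  symmetric e -> connected_graph e -> e x y -> dist e y u <= (dist e x u).+1.
Proof.
move=> symE conE exy; have [p [pP <- <-]] := dist_witness (conE x u).
by have := @dist_path_leq _ e y (x :: p); rewrite /= symE exy pP; exact.
Qed.

(** * Breadth-first parents toward a root *)

Lemma dist_pred (T : finType) (e : rel T) (x r : T) :
    symmetric e -> connected_graph e -> x != r ->
  exists2 y, e x y & dist e x r = (dist e y r).+1.
Proof.
move=> symE conE; have [[|y p] /= [pP lp sz]] := dist_witness (conE x r).
  by rewrite lp eqxx.
case/andP: pP => exy pP _; exists y => //; apply/eqP.
rewrite eqn_leq dist_edge //=; last by rewrite symE.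
by rewrite -sz ltnS -lp dist_path_leq.
Qed.

(** One fixed choice among the neighbours nearer to [r]; the default makes [r] its own parent. *)
Definition parent (T : finType) (e : rel T) (r x : T) : T :=
  odflt x [pick y | e x y && (dist e x r == (dist e y r).+1)].

Lemma parentP (T : finType) (e : rel T) (r x : T) :
    symmetric e -> connected_graph e -> x != r ->
  e x (parent e r x) /\ dist e x r = (dist e (parent e r x) r).+1.
Proof.
move=> symE conE xr; rewrite /parent; case: pickP => [y /andP[-> /eqP]|] //=.
by have [y exy /eqP dxy] := dist_pred symE conE xr; move/(_ y); rewrite exy dxy.
Qed.

Lemma dist_eq0 (T : finType) (e : rel T) (x r : T) :
  symmetric e -> connected_graph e -> (dist e x r == 0) = (x == r).
Proof.
move=> symE conE; have [->|xr] := eqVneq x r; first by rewrite distxx.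
by have [_ ->] := parentP symE conE xr.
Qed.

(** Exact depths tell the ancestors of [v] apart; the second bound places them in balls around
    [v]. *)
Lemma dist_iter_parent (T : finType) (e : rel T) (r v : T) (i : nat) :
    symmetric e -> connected_graph e -> i <= dist e v r ->
  dist e (iter i (parent e r) v) r = dist e v r - i
  /\ dist e (iter i (parent e r) v) v <= i.
Proof.
move=> symE conE; elim: i => [|i IH] lei /=; first by rewrite subn0 distxx.
have [h1 h2] := IH (ltnW lei).
have nr : iter i (parent e r) v != r.
  by rewrite -(dist_eq0 _ _ symE conE) // h1 -lt0n subn_gt0.
have [ep dp] := parentP symE conE nr; split.
  by rewrite subnS -h1 dp.
by apply: leq_trans (dist_edge _ symE conE ep) _.
Qed.

(** * Endpaths and their position relative to the root *)

Lemma degree1_eq (T : finType) (e : rel T) (x a y : T) :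
  degree e x = 1 -> e x a -> e x y -> y = a.
Proof.
move=> /eqP /cards1P[b Nx] xa xy.
have /set1P -> : y \in [set b] by rewrite -Nx inE.
by have /set1P -> : a \in [set b] by rewrite -Nx inE.
Qed.

Lemma degree2_eq (T : finType) (e : rel T) (x a b y : T) :
  degree e x = 2 -> a != b -> e x a -> e x b -> e x y -> y = a \/ y = b.
Proof.
move=> dx ab xa xb xy; have /eqP Nx : [set a; b] == [set u | e x u].
  rewrite eqEcard cards2 ab -[#|_|]/(degree e x) dx leqnn andbT.
  by apply/subsetP => z /set2P[] ->; rewrite inE.
by have : y \in [set a; b]; [rewrite Nx inE | move/set2P].
Qed.

Lemma endpath_cons (T : finType) (e : rel T) (v l x : T) (q : seq T) :
  endpath e v l (x :: q) -> [/\ e v x, endpath e x l q & v \notin x :: q].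
Proof.
case/and3P=> /and3P[/= /andP[vx pq] lq /andP[vn uq]] lf A; split=> //.
rewrite /endpath /upath /= pq lq uq lf /=.
by case: (q) A => //= y q' /andP[].
Qed.

Lemma endpath_cons2 (T : finType) (e : rel T) (v l x y : T) (q : seq T) :
  endpath e v l [:: x, y & q] -> [/\ degree e x = 2, v != y & e x y].
Proof.
move=> E; have [_ /endpath_cons[-> _ _] _] := endpath_cons E.
case/endpath_cons: (E) => _ _; rewrite !inE !negb_or => /and3P[_ -> _].
by case/and3P: E => _ _ /= /andP[/eqP-> _].
Qed.

Lemma endpath1 (T : finType) (e : rel T) (v l x : T) :
  endpath e v l [:: x] -> degree e x = 1 /\ x = l.
Proof. by case/and3P=> /and3P[_ /= /eqP-> _] /eqP-> _. Qed.

(** Hence a branch vertex can occur on an endpath only as its first vertex. *)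
Lemma endpath_degree (T : finType) (e : rel T) (v l x : T) (p : seq T) :
  endpath e v l p -> x \in p -> degree e x <= 2.
Proof.
elim: p v => // y [|z q] IH v E.
  by rewrite inE => /eqP ->; case/endpath1: E => ->.
rewrite inE => /predU1P[->|]; first by case/endpath_cons2: E => ->.
by case/endpath_cons: E => _ E _; exact: IH E.
Qed.

(** Internal vertices have both neighbours on the path and the leaf has only its predecessor, so an
    endpath can be left only through [v]. *)
Lemma endpath_nbr (T : finType) (e : rel T) (v l x y : T) (p : seq T) :
  symmetric e -> endpath e v l p -> x \in p -> e x y -> y \in v :: p.
Proof.
move=> symE; elim: p v => // z q IH v E; have [evz Eq _] := endpath_cons E.
rewrite inE => /predU1P[-> zy|xq xy]; last first.
  by rewrite inE (IH z Eq xq xy) orbT.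
rewrite symE in evz; case: q => [|t q] in E Eq IH *.
  by have [dz _] := endpath1 E; rewrite (degree1_eq dz evz zy) mem_head.
have [dz vt zt] := endpath_cons2 E.
by case: (degree2_eq dz vt evz zt zy) => ->; rewrite !inE eqxx ?orbT.
Qed.

(** Once [x] is chosen, degrees 2 and 1 force every later step. Distinct leaves of [v] thus lie
    behind distinct neighbours. *)
Lemma endpath_inj (T : finType) (e : rel T) (v l l' x : T) (q q' : seq T) :
  symmetric e -> endpath e v l (x :: q) -> endpath e v l' (x :: q') -> l = l'.
Proof.
move=> symE; elim: q v x q' => [|y q IH] v x [|y' q'] E E'.
- by case: (endpath1 E) => _ <-; case: (endpath1 E').
- by case: (endpath1 E) => dx; case: (endpath_cons2 E'); rewrite dx.
- by case: (endpath1 E') => dx; case: (endpath_cons2 E); rewrite dx.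
have [evx Ex _] := endpath_cons E.
have [_ Ex' _] := endpath_cons E'.
have [dx vy xy] := endpath_cons2 E.
have [_ vy' xy'] := endpath_cons2 E'.
rewrite symE in evx; case: (degree2_eq dx vy evx xy xy') => yy'.
  by rewrite yy' eqxx in vy'.
by rewrite yy' in Ex'; exact: IH Ex Ex'.
Qed.

Lemma endpath_parent (T : finType) (e : rel T) (r v l x : T) (q : seq T) :
    symmetric e -> connected_graph e ->
  endpath e v l (x :: q) -> r \notin x :: q -> parent e r x = v.
Proof.
move=> symE conE; elim: q v x => [|y q IH] v x E;
  rewrite in_cons => /norP[rx rq];
  have [evx Ex _] := endpath_cons E; rewrite symE in evx;
  rewrite eq_sym in rx; have [ep dp] := parentP symE conE rx.
  by case: (endpath1 E) => dx _; exact: degree1_eq dx evx ep.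
have [dx vy xy] := endpath_cons2 E.
(* If the parent of [x] were the next vertex [y], then [x] would be the parent of [y] by induction,
   and each would be deeper than the other. *)
case: (degree2_eq dx vy evx xy ep) => // py.
have yr : y != r by move: rq; rewrite in_cons eq_sym => /norP[].
have [_] := parentP symE conE yr.
by rewrite (IH x y Ex rq) dp py => /eqP; rewrite -addn2 -[X in X == _]addn0 eqn_add2l.
Qed.

(* An endpath communicates with the rest of the graph only through its first
   vertex [w]. *)
Lemma endpath_root_dist (T : finType) (e : rel T) (r w l y : T) (p : seq T) :
    symmetric e -> connected_graph e -> endpath e w l p -> r \in w :: p ->
  y \notin w :: p -> dist e w r < dist e y r.
Proof.
move=> symE conE E rp; have [n] := ubnP (dist e y r); elim: n y => // n IH y.
rewrite ltnS => len yp; have yr : y != r by apply: contraNneq yp => ->.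
have [ey dy] := parentP symE conE yr.
have [pw|pw] := eqVneq (parent e r y) w; first by rewrite dy pw.
rewrite dy; apply/ltnW; rewrite ltnS; apply: IH; first by rewrite -dy.
rewrite inE (negPf pw) /=; apply: contra yp => py.
by apply: (endpath_nbr symE E py); rewrite symE.
Qed.

(** If [w] and [w'] differ, each lies off the other's endpath because of its degree, so each would
    be strictly nearer to [r] than the other. *)
Lemma endpath_root_unique (T : finType) (e : rel T) (r w l w' l' : T)
    (p p' : seq T) :
    symmetric e -> connected_graph e ->
    w \in branch_set e -> w' \in branch_set e ->
    endpath e w l p -> r \in w :: p -> endpath e w' l' p' -> r \in w' :: p' ->
  w = w'.
Proof.
move=> symE conE; rewrite !inE => bw bw' E rp E' rp'; apply/eqP.
have notin (a b k : T) s : endpath e a k s -> 2 < degree e b -> b != a -> b \notin a :: s.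
  move=> Es db /negPf ba; rewrite inE ba /=; apply: contraL db => bs.
  by rewrite -leqNgt; exact: endpath_degree Es bs.
apply: contraT => ww'; rewrite -(ltnn (dist e w r)).
apply: (@ltn_trans (dist e w' r)).
  by apply: (endpath_root_dist symE conE E rp); rewrite ?(notin _ _ _ _ E) // eq_sym.
by apply: (endpath_root_dist symE conE E' rp'); rewrite ?(notin _ _ _ _ E').
Qed.

(** * Interiors of broadcast balls *)

Lemma bn_hears_unique (T : finType) (e : rel T) (f : {ffun T -> 'I_(diam e).+1})
    (x u v : T) :
    bn_independent f -> dist e x u < f u -> 0 < f v -> dist e x v <= f v -> u = v.
Proof.
move=> /forallP /(_ x) /implyP bn du fv dv; apply/eqP; apply: contraT => uv.
have hu : u \in heard_from f x by rewrite inE (leq_trans _ du) // ltnW.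
have hv : v \in heard_from f x by rewrite inE fv dv.
have two : 2 <= #|heard_from f x|.
  (* [cards2] gives [#|[set u; v]|] as [(u != v).+1], so 2 is first written in that shape. *)
  by rewrite -[2]/(true.+1) -uv -cards2 subset_leq_card // subUset !sub1set hu.
by have /forallP/(_ u) := bn two; rewrite hu /= => /eqP eq_d; rewrite eq_d ltnn in du.
Qed.

Lemma exists_noninterior (T : finType) (e : rel T)
    (f : {ffun T -> 'I_(diam e).+1}) (x0 : T) :
    symmetric e -> connected_graph e -> is_broadcast f -> bn_independent f ->
  exists r, forall v, f v <= dist e r v.
Proof.
move=> symE conE /forallP bf bn.
have [/existsP[r /forallP Hr]|] := boolP [exists r, forall v, f v <= dist e r v].
  by exists r.
rewrite negb_exists => /forallP none.
have int x : exists v, dist e x v < f v.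
  by have := none x; rewrite negb_forall => /existsP[v]; rewrite -ltnNge; exists v.
have [u du] := int x0.
(* If the ball of [u] holds every vertex in its interior, then [f u] exceeds the eccentricity of
   [u]. *)
suff all_u y : dist e y u < f u.
  have := bf u; rewrite leqNgt => /negP[]; rewrite /ecc.
  have fu : 0 < f u by apply: leq_ltn_trans du.
  rewrite -(ltn_predK fu) ltnS; apply/bigmax_leqP => y _.
  by rewrite -ltnS (ltn_predK fu) dist_sym.
have /connectP[p pP ->] := conE x0 y.
elim: p x0 du pP => //= z p IH x du /andP[xz]; apply: IH.
(* A neighbour [z] of an interior vertex still hears [u]; being interior to the ball of [v], it
   forces [v = u]. *)
have [v dv] := int z; suff <- : v = u by [].
apply: (bn_hears_unique bn dv); first exact: leq_ltn_trans du.
exact: leq_trans (dist_edge _ symE conE xz) du.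
Qed.

(** * Claimed vertices *)

(** The indices start at 0, so [v] claims itself first and stops short of the boundary of its
    ball. *)
Definition claimed (T : finType) (e : rel T) (f : {ffun T -> 'I_(diam e).+1})
    (r v : T) : {set T} :=
  [set iter i (parent e r) v | i : 'I_(f v)].

Lemma claimedP (T : finType) (e : rel T) (f : {ffun T -> 'I_(diam e).+1})
    (r v x : T) :
    symmetric e -> connected_graph e -> (forall v, f v <= dist e r v) ->
    x \in claimed f r v ->
  exists i, [/\ i < f v, x = iter i (parent e r) v,
                dist e x r = dist e v r - i, i < dist e v r & dist e x v <= i].
Proof.
move=> symE conE le_f /imsetP[i _ xE]; exists i.
have lt_i : i < dist e v r by rewrite dist_sym //; apply: leq_trans (le_f v).
by have [d1 d2] := dist_iter_parent symE conE (ltnW lt_i); rewrite xE d1.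
Qed.

(** Ancestors at different depths differ, so [v] claims exactly [f v] vertices; a vertex claimed
    twice would be interior to two balls. *)
Lemma card_claimed (T : finType) (e : rel T) (f : {ffun T -> 'I_(diam e).+1})
    (r : T) :
    symmetric e -> connected_graph e -> bn_independent f ->
    (forall v, f v <= dist e r v) ->
  weight f = #|\bigcup_v claimed f r v|.
Proof.
move=> symE conE bn le_f; rewrite -sum1_card partition_disjoint_bigcup /=.
  apply: eq_bigr => v _; rewrite sum1_card card_imset ?card_ord // => i j.
  have le_i (k : 'I_(f v)) : k <= dist e v r.
    by rewrite dist_sym // (leq_trans (ltnW (ltn_ord k))).
  have [di _] := dist_iter_parent symE conE (le_i i).
  have [dj _] := dist_iter_parent symE conE (le_i j).
  move=> eq_ij; apply: val_inj => /=; apply/eqP.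
  by rewrite -(eqn_sub2lE (le_i i) (le_i j)) -di -dj eq_ij.
move=> u v; apply: contraNT => /pred0Pn[x /andP[/=]].
move=> /(claimedP symE conE le_f)[i [lti _ _ _ dxu]].
move=> /(claimedP symE conE le_f)[j [ltj _ _ _ dxv]].
apply/eqP; apply: (bn_hears_unique bn (leq_ltn_trans dxu lti)).
  exact: leq_ltn_trans ltj.
exact: leq_trans dxv (ltnW ltj).
Qed.

Lemma claimed_children (T : finType) (e : rel T) (f : {ffun T -> 'I_(diam e).+1})
    (r w c1 c2 : T) :
    symmetric e -> connected_graph e -> bn_independent f ->
    (forall v, f v <= dist e r v) ->
    c1 != r -> c2 != r -> parent e r c1 = w -> parent e r c2 = w ->
    {subset [:: w; c1; c2] <= \bigcup_v claimed f r v} -> c1 = c2.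
Proof.
move=> symE conE bn le_f c1r c2r p1 p2 sub.
have claim := claimedP symE conE le_f.
have /bigcupP[v _ /claim[i [lti _ _ _ dwv]]] : w \in \bigcup_v claimed f r v.
  by apply: sub; rewrite !inE eqxx.
have child c : c \in [:: w; c1; c2] -> c != r -> parent e r c = w ->
    exists2 i, c = iter i (parent e r) v & dist e c r = dist e v r - i /\ i < dist e v r.
  move=> /sub/bigcupP[u _ /claim[j [ltj cE dc ltd dcu]]] cr pc.
  suff -> : v = u by exists j.
  (* Here [w] is interior to the ball of its claimant [v], and it hears [u] because its child [c] is
     interior to the ball of [u]. *)
  apply: (bn_hears_unique bn (leq_ltn_trans dwv lti)).
    exact: leq_ltn_trans ltj.
  have [ec _] := parentP symE conE cr; rewrite pc in ec.
  by apply: leq_trans (dist_edge _ symE conE ec) _; apply: leq_ltn_trans ltj.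
have [|j1 c1E [d1 lt1]] := child c1 _ c1r p1; first by rewrite !inE eqxx orbT.
have [|j2 c2E [d2 lt2]] := child c2 _ c2r p2; first by rewrite !inE eqxx !orbT.
have [_ e1] := parentP symE conE c1r.
have [_ e2] := parentP symE conE c2r.
(* Both children are ancestors of the same [v] at the same depth, hence equal. *)
rewrite c1E c2E; congr iter; apply/eqP; rewrite -(eqn_sub2lE (ltnW lt1) (ltnW lt2)).
by rewrite -d1 -d2 e1 e2 p1 p2.
Qed.

(** * Charging branch vertices to unclaimed vertices *)

Lemma weight_bound (T : finType) (e : rel T) (f : {ffun T -> 'I_(diam e).+1}) :
    symmetric e -> connected_graph e -> is_broadcast f -> bn_independent f ->
    0 < #|T| ->
  weight f + #|branch_set e :\: R_set e| <= #|T|.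
Proof.
move=> symE conE bf bn /card_gt0P[x0 _].
have [r le_f] := exists_noninterior x0 symE conE bf bn.
rewrite (card_claimed symE conE bn le_f).
set U := \bigcup_v _; set B := _ :\: _.
(* Bad means that some endpath from [w], with [w] included, meets the root; such a [w] is charged to
   [r]. *)
pose bad w := [exists l, exists n : 'I_#|T|, exists p : n.-tuple T,
  endpath e w l p && (r \in w :: p)].
have badB : #|[set w in B | bad w]| <= 1.
  apply/card_le1_eqP => w w'.
  rewrite !inE => /andP[/andP[_ bw]] /existsP[l /existsP[n /existsP[p /andP[E rp]]]].
  move=> /andP[/andP[_ bw']] /existsP[l' /existsP[n' /existsP[p' /andP[E' rp']]]].
  by apply: (endpath_root_unique symE conE _ _ E' rp' E rp); rewrite inE.
(* Claimed vertices have positive depth. *)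
have rU : r \notin U.
  apply/negP => /bigcupP[v _ /(claimedP symE conE le_f)[i [_ _]]].
  by rewrite distxx => /esym/eqP; rewrite subn_eq0 leqNgt => /negP.
(* [head] sends an unclaimed vertex to the branch vertex it may pay for: itself, or the parent when
   it is the first vertex of an endpath. *)
pose head x := if 2 < degree e x then x else parent e r x.
have goodB : #|[set w in B | ~~ bad w]| <= #|~: U :\ r|.
  suff /subset_leq_card/leq_trans -> :
    [set w in B | ~~ bad w] \subset head @: (~: U :\ r) by rewrite // leq_imset_card.
  apply/subsetP => w; rewrite 2!inE => /andP[/andP[wR bw] nbad].
  have : 1 < #|leaf_set e w| by move: wR; rewrite inE bw /= -ltnNge.
  case/card_gt1P => l1 [l2 [L1 L2 l12]].
  have child l : l \in leaf_set e w -> exists c q,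
      [/\ endpath e w l (c :: q), r \notin w :: c :: q, parent e r c = w & head c = w].
    rewrite inE => /existsP[n /existsP[p E]].
    have rp : r \notin w :: p.
      apply: contra nbad => rp; apply/existsP; exists l; apply/existsP; exists n.
      by apply/existsP; exists p; rewrite E.
    case: (tval p) E rp => [|c q] E rp.
      (* An empty endpath would make the branch vertex [w] a leaf. *)
      by case/and3P: E => /and3P[_ /eqP<- _] /eqP /= d1; move: bw; rewrite inE d1.
    have pc : parent e r c = w.
      by apply: (endpath_parent symE conE E); case/norP: rp.
    exists c, q; rewrite /head ltnNge (endpath_degree E) ?mem_head //.
  have [c1 [q1 [E1 r1 p1 h1]]] := child _ L1.
  have [c2 [q2 [E2 r2 p2 h2]]] := child _ L2.
  have hw : head w = w by move: bw; rewrite inE /head => ->.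
  move: (r1) (r2); rewrite !inE !negb_or => /and3P[rw rc1 _] /and3P[_ rc2 _].
  (* Were all three claimed, [c1 = c2] would follow, and then the two leaves would coincide. *)
  have : ~~ all (mem U) [:: w; c1; c2].
    apply: contra l12 => /allP sub; apply/eqP.
    have c12 : c1 = c2.
      by apply: (claimed_children symE conE bn le_f _ _ p1 p2 sub); rewrite eq_sym.
    by rewrite -c12 in E2; exact: endpath_inj symE E1 E2.
  case/allPn => x; rewrite !inE => x3 xU; apply/imsetP; exists x.
    rewrite !inE xU andbT.
    by case/or3P: x3 => /eqP ->; rewrite eq_sym.
  by case/or3P: x3 => /eqP ->.
have -> : #|B| = #|[set w in B | bad w]| + #|[set w in B | ~~ bad w]|.
  rewrite -(cardsID [set w | bad w] B); congr (_ + _); apply: eq_card => x.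
    by rewrite !inE.
  by rewrite !inE andbC.
rewrite -(cardsC U) leq_add2l (cardsD1 r (~: U)) inE rU.
exact: leq_add.
Qed.

Theorem theorem1p1 (T : finType) (e : rel T) (tree_e : tree e)
    (order_ge2 : 2 <= #|T|) :
  alpha_bn e <= #|T| - #|branch_set e| + #|R_set e|.
Proof.
have [[symE _] conE _] := tree_e.
apply/bigmax_leqP => f /andP[bf bn].
have := weight_bound symE conE bf bn (ltnW order_ge2).
have sub : R_set e \subset branch_set e by apply/subsetP => w; rewrite inE => /andP[].
rewrite cardsD (setIidPr sub) => le_w.
(* These inclusions make the truncated subtractions exact. *)
have le_RB := subset_leq_card sub; have le_BT := max_card (mem (branch_set e)).
by rewrite -subnA // leq_subRL ?(leq_trans (leq_subr _ _)) // addnC.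
Qed.
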